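(* For all integers $N\ge 1$ and $n\ge 0$, $$\sum_{i=0}^n\binom{n}{i}E_{N,i}E_{N,n-i}=\sum_{k=0}^n\binom{n}{k}\frac{2N-k}{2N}E_{N,k}\,\widehat E_{N-1,n-k}.$$
   Context: For an integer $N\ge 0$, the hypergeometric Euler numbers $E_{N,n}$ are defined by $\dfrac{1}{\sum_{m\ge 0}\frac{(2N)!}{(2N+2m)!}t^{2m}}=\sum_{n=0}^\infty E_{N,n}\frac{t^n}{n!}$ (the denominator equals ${}_1F_2(1;N+1,\tfrac{2N+1}{2};\tfrac{t^2}{4})$; equivalently $\sum_nE_{N,n}t^n/n!=\frac{t^{2N}/(2N)!}{\cosh t-\sum_{m=0}^{N-1}t^{2m}/(2m)!}$). For an integer $M\ge 0$, the complementary hypergeometric Euler numbers $\widehat E_{M,n}$ are defined by $$\frac{t^{2M+1}/(2M+1)!}{\sinh t-\sum_{m=0}^{M-1}t^{2m+1}/(2m+1)!}=\sum_{n=0}^\infty\widehat E_{M,n}\frac{t^n}{n!},$$ equivalently $1/\sum_{m\ge0}\frac{(2M+1)!}{(2M+2m+1)!}t^{2m}=\sum_n\widehat E_{M,n}t^n/n!$. *)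

(* Defs.v *)
From mathcomp Require Import all_boot all_order all_algebra.

Set Implicit Arguments.
Unset Strict Implicit.
Unset Printing Implicit Defensive.

Import GRing.Theory.
Local Open Scope ring_scope.

(* A formal power series over rat is its coefficient sequence; two series     *)
(* are equal when they agree pointwise (=1).                                  *)
Definition fps : Type := nat -> rat.

Definition fps_mul (f g : fps) : fps :=
  fun n => \sum_(i < n.+1) f i * g (n - i)%N.

Definition fps_sub (f g : fps) : fps := fun n => f n - g n.

(* c t^k *)
Definition fps_mono (c : rat) (k : nat) : fps :=
  fun n => if n == k then c else 0.

(* Division of f by t^v, when f has order at least v. *)
Definition fps_shift (v : nat) (f : fps) : fps := fun n => f (n + v)%N.

(* [:: g_0; ...; g_n] with g_0 = 1 / f_0 and                                  *)
(* g_n = - (\sum_(i < n) f_(n - i) g_i) / f_0.                                *)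
Fixpoint fps_inv_seq (f : fps) (n : nat) : seq rat :=
  if n is m.+1 then
    let s := fps_inv_seq f m in
    rcons s (- (f 0%N)^-1 * \sum_(i < m.+1) f (m.+1 - i)%N * s`_i)
  else [:: (f 0%N)^-1].

(* Multiplicative inverse of f, meaningful when f 0 != 0 (see fps_mulV). *)
Definition fps_inv (f : fps) : fps := fun n => (fps_inv_seq f n)`_n.

(* Quotient f / g where g has order exactly v and f order at least v          *)
(* (see fps_divK).                                                            *)
Definition fps_div (v : nat) (f g : fps) : fps :=
  fps_mul (fps_shift v f) (fps_inv (fps_shift v g)).

(* Exponential generating function \sum_n a_n t^n / n! *)
Definition egf (a : nat -> rat) : fps := fun n => a n / (n`!)%:R.

Definition fps_sinh : fps := fun j => if odd j then ((j`!)%:R)^-1 else 0.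

(* \sum_(m >= 0) (2N)! / (2N + 2m)! t^(2m) *)
Definition hgE_den (N : nat) : fps :=
  fun j => if odd j then 0 else ((2 * N)`!)%:R / ((2 * N + j)`!)%:R.

(* sinh t - \sum_(m < M) t^(2m+1) / (2m+1)! *)
Definition sinh_tail (M : nat) : fps :=
  fps_sub fps_sinh
    (fun j => \sum_(m < M) fps_mono (((2 * m + 1)`!)%:R)^-1 (2 * m + 1) j).

(* The hypergeometric Euler numbers E_{N,n}. *)
Definition hgE (N n : nat) : rat := (n`!)%:R * fps_inv (hgE_den N) n.

(* The complementary hypergeometric Euler numbers \hat E_{M,n}. *)
Definition chgE (M n : nat) : rat :=
  (n`!)%:R *
  fps_div (2 * M + 1)
    (fps_mono (((2 * M + 1)`!)%:R)^-1 (2 * M + 1)) (sinh_tail M) n.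

Lemma size_fps_inv_seq (f : fps) n : size (fps_inv_seq f n) = n.+1.
Proof. by elim: n => //= n IHn; rewrite size_rcons IHn. Qed.

Lemma nth_fps_inv_seq (f : fps) n i : (i <= n)%N ->
  (fps_inv_seq f n)`_i = fps_inv f i.
Proof.
elim: n => [|n IHn]; first by rewrite leqn0 => /eqP->.
rewrite leq_eqVlt => /orP[/eqP->//|lein].
by rewrite /= nth_rcons size_fps_inv_seq lein IHn.
Qed.

Lemma fps_invS (f : fps) n : fps_inv f n.+1 =
  - (f 0%N)^-1 * \sum_(i < n.+1) f (n.+1 - i)%N * fps_inv f i.
Proof.
rewrite {1}/fps_inv /= nth_rcons size_fps_inv_seq ltnn eqxx.
by congr (_ * _); apply: eq_bigr => i _; rewrite nth_fps_inv_seq // -ltnS.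
Qed.

Lemma fps_mulC (f g : fps) : fps_mul f g =1 fps_mul g f.
Proof.
move=> n; rewrite /fps_mul (reindex_inj rev_ord_inj) /=.
by apply: eq_bigr => i _; rewrite subSS subKn 1?mulrC // -ltnS.
Qed.

Lemma fps_mulV (f : fps) : f 0%N != 0 -> fps_mul f (fps_inv f) =1 fps_mono 1 0.
Proof.
move=> f0 n; rewrite fps_mulC /fps_mul /fps_mono.
case: n => [|n]; first by rewrite big_ord1 /= /fps_inv /= mulVf.
rewrite big_ord_recr /= subnn fps_invS mulrAC mulNr mulVf // mulN1r.
by apply/eqP; rewrite subr_eq0; apply/eqP/eq_bigr => i _; rewrite mulrC.
Qed.

Lemma fps_mulA (f g h : fps) :
  fps_mul f (fps_mul g h) =1 fps_mul (fps_mul f g) h.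
Proof.
have coefP n (u v : fps) : fps_mul u v n =
    (\poly_(i < n.+1) u i * \poly_(i < n.+1) v i)`_n.
  rewrite coefM; apply: eq_bigr => i _.
  by rewrite !coef_poly ltn_ord ltnS leq_subr.
have coefL n (u v : fps) k : (k <= n)%N -> fps_mul u v k =
    (\poly_(i < n.+1) u i * \poly_(i < n.+1) v i)`_k.
  move=> lekn; rewrite coefM; apply: eq_bigr => i _.
  have lein : (i <= n)%N by apply: leq_trans lekn; rewrite -ltnS.
  by rewrite !coef_poly !ltnS lein (leq_trans (leq_subr _ _) lekn).
move=> n; set p := fun u : fps => \poly_(i < n.+1) u i.
have -> : fps_mul f (fps_mul g h) n = (p f * (p g * p h))`_n.
  rewrite coefM; apply: eq_bigr => i _.
  by rewrite -(coefL n) ?leq_subr // coef_poly ltn_ord.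
rewrite mulrA coefM; apply: eq_bigr => i _.
by rewrite -(coefL n) -1?ltnS // coef_poly ltnS leq_subr.
Qed.

Lemma eq_fps_mul (f f' g g' : fps) :
  f =1 f' -> g =1 g' -> fps_mul f g =1 fps_mul f' g'.
Proof. by move=> ef eg n; apply: eq_bigr => i _; rewrite ef eg. Qed.

Lemma fps_mul1 (f : fps) : fps_mul (fps_mono 1 0) f =1 f.
Proof.
move=> n; rewrite /fps_mul big_ord_recl big1 /= ?mul1r ?subn0 ?addr0 // => i _.
by rewrite mul0r.
Qed.

Lemma fps_mul_mono (f : fps) c k n :
  fps_mul (fps_mono c k) f (n + k)%N = c * f n.
Proof.
have lt : (k < (n + k).+1)%N by rewrite ltnS leq_addl.
rewrite /fps_mul (bigD1 (Ordinal lt)) //= /fps_mono eqxx addnK big1 ?addr0 //.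
by move=> i /negPf ne; rewrite -[i == k :> nat]/(i == Ordinal lt) ne mul0r.
Qed.

Lemma fps_mul_mono_lt (f : fps) c k n :
  (n < k)%N -> fps_mul (fps_mono c k) f n = 0.
Proof.
move=> lt; rewrite /fps_mul big1 // => i _; rewrite /fps_mono.
by rewrite ltn_eqF ?mul0r // (leq_trans _ lt) // ltnS -ltnS.
Qed.

Lemma fps_shiftK (f : fps) v : (forall j, (j < v)%N -> f j = 0) ->
  fps_mul (fps_mono 1 v) (fps_shift v f) =1 f.
Proof.
move=> f0 n; case: (ltnP n v) => [lt|le]; first by rewrite fps_mul_mono_lt ?f0.
by rewrite -(subnK le) fps_mul_mono mul1r.
Qed.

Lemma fps_divK (f g : fps) v :
  (forall j, (j < v)%N -> f j = 0) -> (forall j, (j < v)%N -> g j = 0) ->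
  g v != 0 -> fps_mul g (fps_div v f g) =1 f.
Proof.
move=> f0 g0 gv n; rewrite -[RHS](fps_shiftK f0) /fps_div.
rewrite -(eq_fps_mul (fps_shiftK g0) (frefl _)).
rewrite -fps_mulA; apply: eq_fps_mul => // k.
rewrite (eq_fps_mul (frefl _) (fps_mulC _ _)) fps_mulA.
by rewrite (eq_fps_mul (fps_mulV _) (frefl _)) ?fps_mul1.
Qed.

Lemma sinh_tailE M j : sinh_tail M j =
  if odd j && (2 * M < j)%N then ((j`!)%:R)^-1 else 0.
Proof.
rewrite /sinh_tail /fps_sub /fps_sinh /fps_mono.
elim: M => [|M IHM].
  by rewrite big_ord0 subr0 muln0; case: j => // j; rewrite ltn0Sn andbT.
rewrite big_ord_recr /= opprD addrA IHM mulnS add2n.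
case: (altP (j =P (2 * M + 1)%N)) => [->|ne].
  by rewrite oddD mul2n odd_double /= addn1 ltnSn subrr ltnNge leqnSn.
rewrite subr0; case: (boolP (odd j)) => //= oj.
suff -> : (2 * M < j)%N = ((2 * M).+2 < j)%N by [].
rewrite [LHS]leq_eqVlt eq_sym -addn1 (negPf ne) /= addn1 leq_eqVlt.
by case: eqP => // ej; rewrite -ej /= negbK mul2n odd_double in oj.
Qed.

Lemma factQ_neq0 n : (n`!)%:R != 0 :> rat.
Proof. by rewrite Num.Theory.pnatr_eq0 -lt0n fact_gt0. Qed.

Lemma egf_factM (f : fps) : egf (fun n => (n`!)%:R * f n) =1 f.
Proof. by move=> n; rewrite /egf mulrAC mulfV ?mul1r // factQ_neq0. Qed.

(* The defining generating functions, as identities with cleared             *)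
(* denominators.                                                              *)
Lemma hgE_egf N : fps_mul (hgE_den N) (egf (hgE N)) =1 fps_mono 1 0.
Proof.
move=> n; rewrite (eq_fps_mul (frefl _) (egf_factM _)) fps_mulV //.
by rewrite /hgE_den /= addn0 divff ?oner_eq0 ?factQ_neq0.
Qed.

Lemma chgE_egf M : fps_mul (sinh_tail M) (egf (chgE M)) =1
  fps_mono (((2 * M + 1)`!)%:R)^-1 (2 * M + 1).
Proof.
move=> n; rewrite (eq_fps_mul (frefl _) (egf_factM _)) fps_divK //.
- by move=> j lt; rewrite /fps_mono ltn_eqF.
- by move=> j; rewrite addn1 ltnS sinh_tailE => le; rewrite ltnNge le andbF.
rewrite sinh_tailE oddD mul2n odd_double /= addn1 ltnSn.
by rewrite invr_eq0 factQ_neq0.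
Qed.

(* Main.v *)
(* Put D = hgE_den N, F = 1/D, m = 2N, and let C be the generating series of
   (m-1)!/(m-1+j)! over even j, whose inverse G generates the complementary
   numbers.  Coefficientwise D + t D'/m = C.  Since F D = 1 has zero Euler
   derivative, (F - t F'/m) D = F (D + t D'/m) = F C, and multiplying by F G
   gives (F - t F'/m) G = F F, which is the claim in terms of coefficients. *)
Require Import Defs.
From mathcomp Require Import all_boot all_order all_algebra.
From mathcomp Require Import ring.

Import GRing.Theory.
Local Open Scope ring_scope.

Lemma egf_mul (a b : nat -> rat) n :
  \sum_(0 <= i < n.+1) ('C(n, i))%:R * a i * b (n - i)%N =
  (n`!)%:R * fps_mul (egf a) (egf b) n.
Proof.
rewrite big_mkord /fps_mul mulr_sumr; apply: eq_bigr => i _.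
have lein : (i <= n)%N by rewrite -ltnS.
rewrite -(bin_fact lein) !natrM /egf.
by field; rewrite !factQ_neq0.
Qed.

(* With theta = t d/dt, the two sides differ by b theta(f g) = b theta(1) = 0. *)
Lemma fps_mul_euler (f g : fps) (b : rat) :
  fps_mul f g =1 fps_mono 1 0 ->
  fps_mul (fun k => (1 - b * k%:R) * f k) g =1
  fps_mul f (fun k => (1 + b * k%:R) * g k).
Proof.
move=> fg1 n; apply/eqP; rewrite eq_sym -subr_eq0 -sumrB.
rewrite (eq_bigr (fun i : 'I_n.+1 => b * n%:R * (f i * g (n - i)%N))).
  rewrite -mulr_sumr -[X in _ * X]/(fps_mul f g n) fg1 /fps_mono.
  by case: n => [|n]; rewrite ?mulr0 ?mul0r.
move=> i _; rewrite natrB -1?ltnS //; ring.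
Qed.

(** At even [j] the weight is (2M+2+j)/(2M+2), which strips the top factor from both factorials; at
    odd [j] both sides vanish. *)
Lemma hgE_den_euler M j :
  (1 + ((2 * M.+1)%:R)^-1 * j%:R) * hgE_den M.+1 j =
  ((2 * M + 1)`!)%:R * fps_shift (2 * M + 1) (sinh_tail M) j.
Proof.
rewrite /hgE_den; have -> : (2 * M.+1 = (2 * M + 1).+1)%N by rewrite mulnS add2n addn1.
have lt : (2 * M < j + (2 * M + 1))%N by rewrite addnA addn1 ltnS leq_addl.
rewrite /fps_shift sinh_tailE lt andbT oddD oddD mul2n odd_double -mul2n.
rewrite addbT (addnC j); case: (odd j); first by rewrite !mulr0.
move: (2 * M + 1)%N => v /=; rewrite addSn !factS !natrM -addSn natrD.
have nz k : k.+1%:R != 0 :> rat by rewrite Num.Theory.pnatr_eq0.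
by field; rewrite factQ_neq0 !nat1r -natrD addSn !nz.
Qed.

Lemma sinh_tail_shift_chgE M :
  fps_mul (fun j => ((2 * M + 1)`!)%:R * fps_shift (2 * M + 1) (sinh_tail M) j)
    (egf (chgE M)) =1 fps_mono 1 0.
Proof.
move=> n; set v := (2 * M + 1)%N; set V := fps_shift _ _; set G := egf _.
transitivity ((v`!)%:R * fps_mul V G n).
  by rewrite mulr_sumr; apply: eq_bigr => i _; rewrite mulrA.
have SV : fps_mul (fps_mono 1 v) V =1 sinh_tail M.
  apply: fps_shiftK => k; rewrite /v addn1 ltnS sinh_tailE => le.
  by rewrite ltnNge le andbF.
(* Multiplying by t^v moves coefficient [n] to [n + v], where [chgE_egf] applies. *)
rewrite -[fps_mul V G n]mul1r -(fps_mul_mono _ _ v) fps_mulA.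
rewrite (eq_fps_mul SV (frefl G)) chgE_egf /fps_mono -[X in _ == X]add0n.
by rewrite eqn_add2r; case: eqP; rewrite ?mulr0 // mulfV ?factQ_neq0.
Qed.

Lemma hgE_chgE_egf M :
  fps_mul (fun k => (1 - ((2 * M.+1)%:R)^-1 * k%:R) * egf (hgE M.+1) k)
    (egf (chgE M)) =1
  fps_mul (egf (hgE M.+1)) (egf (hgE M.+1)).
Proof.
set b := _^-1; set F := egf (hgE _); set G := egf _; set D := hgE_den M.+1.
(* With [b] = 1/m, [U] is F - t F'/m and [C] is D + t D'/m. *)
set U := fun k => _; pose C : fps := fun k => (1 + b * k%:R) * D k.
have DF : fps_mul D F =1 fps_mono 1 0 by exact: hgE_egf.
have CG : fps_mul C G =1 fps_mono 1 0.
  move=> n; rewrite -(sinh_tail_shift_chgE M); apply: eq_fps_mul => // k.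
  exact: hgE_den_euler.
have UD : fps_mul U D =1 fps_mul F C.
  by apply: fps_mul_euler => n; rewrite fps_mulC DF.
(* Multiplying [UD] by [F] removes [D], since D F = 1. *)
have UE : U =1 fps_mul F (fps_mul F C).
  move=> n; rewrite -(eq_fps_mul (frefl F) UD) fps_mulC -fps_mulA.
  by rewrite (eq_fps_mul (frefl U) DF) fps_mulC fps_mul1.
move=> n; rewrite (eq_fps_mul UE (frefl G)) -fps_mulA.
apply: eq_fps_mul => // k; rewrite -fps_mulA.
by rewrite (eq_fps_mul (frefl F) CG) fps_mulC fps_mul1.
Qed.

Theorem theorem3 (N n : nat) (hN : (1 <= N)%N) :
  \sum_(0 <= i < n.+1) ('C(n, i))%:R * hgE N i * hgE N (n - i)%N =
  \sum_(0 <= k < n.+1)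
    ('C(n, k))%:R * (((2 * N)%:R - k%:R) / (2 * N)%:R) *
    hgE N k * chgE (N - 1)%N (n - k)%N.
Proof.
case: N hN => // M _; rewrite subn1 /= egf_mul -hgE_chgE_egf.
(* The weight (2N-k)/(2N) = 1 - k/(2N) is absorbed into the sequence [a], so that [egf_mul] can be
   read backwards. *)
set b := _^-1; pose a k := (1 - b * k%:R) * hgE M.+1 k.
have aE : egf a =1 (fun k => (1 - b * k%:R) * egf (hgE M.+1) k).
  by move=> k; rewrite /egf /a -mulrA.
rewrite -(eq_fps_mul aE (frefl _)) -egf_mul; apply: eq_bigr => k _.
congr (_ * _); rewrite -[RHS]mulrA; congr (_ * (_ * _)).
by rewrite mulrBl mulfV ?Num.Theory.pnatr_eq0 // mulrC.
Qed.
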